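(* Let $\mathcal{U}=\{u_1,\ldots,u_n\}$ be a finite set and $f:2^{\mathcal{U}}\to\mathbb{Q}_{\ge 0}$ a nonnegative rational-valued submodular function, with polymatroid $P_f$. Let $w_1,\ldots,w_n$ be independent nonnegative real random variables with known distributions, $w_i$ being the weight of $u_i$. Then there is a deterministic online selection algorithm which, against every online weight-adaptive adversary, outputs a vector $z\in P_f$ satisfying \[\mathbb{E}\Big[\sum_i w_i z_i\Big]\ \ge\ \tfrac12\,\mathbb{E}\Big[\max_{y\in P_f} \sum_i w_i y_i\Big].\]
   Context: A set function $f$ on $2^{\mathcal{U}}$ is submodular if $f(X\cap Y)+f(X\cup Y)\le f(X)+f(Y)$ for all $X,Y\subseteq\mathcal{U}$. The polymatroid is $P_f=\{z\in\mathbb{R}^{\mathcal{U}}:\sum_{i\in T}z_i\le f(T)\ \forall T\subseteq\mathcal{U}\}$. In the online problem the elements of $\mathcal{U}$ are presented one at a time; when element $u$ is presented its weight $w(u)$ is revealed, and the algorithm (knowing the distributions and the weights of previously presented elements, but not future weights) must irrevocably fix the coordinate $z_u$; the final vector $z$ must lie in $P_f$. An online weight-adaptive adversary chooses the presentation order, choosing the next element to present based only on the weights of elements already presented (not on the weight of the element being chosen or of later ones).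
   Formalization: The polymatroid P_f is taken with nonnegative vectors only (z ≥ 0), since with arbitrary real vectors and non-monotone f the claim fails (e.g. f(∅)=f({1})=f({1,2})=0, f({2})=1, w_1=1, w_2 uniform on {0,2}); for monotone f the two optima agree. *)

(* Defs.v *)
From HB Require Import structures.
From mathcomp Require Import all_boot all_order all_algebra.
From mathcomp Require Import all_classical all_reals all_analysis.

Set Implicit Arguments.
Unset Strict Implicit.
Unset Printing Implicit Defensive.

Import Order.TTheory GRing.Theory Num.Theory.
Import numFieldNormedType.Exports.

Local Open Scope classical_set_scope.
Local Open Scope ring_scope.

Definition submodular (U : finType) (f : {set U} -> rat) : Prop :=
  forall X Y : {set U}, f (X :&: Y)%SET + f (X :|: Y)%SET <= f X + f Y.

(* The vectors of the polymatroid are taken nonnegative, as is standard for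
   polymatroids (as opposed to extended polymatroids). For monotone f this does
   not change the optimum (see max_weight_monotone). For non-monotone f the sign
   condition matters: with f {1} = f {1, 2} = f set0 = 0, f {2} = 1, w_1 = 1 and
   w_2 uniform on {0, 2}, presenting element 1 first, an online algorithm that
   may use negative coordinates gains at most 0 in expectation, whereas the
   expected offline optimum over all of R^U is 1/2. *)
Definition polymatroid (R : realType) (U : finType) (f : {set U} -> rat) :
    set (U -> R) :=
  [set z | (forall u, 0 <= z u) /\
           (forall T : {set U}, \sum_(u in T) z u <= ratr (f T))].

(* A maximum whenever f is nonnegative (see max_weightP). *)
Definition max_weight (R : realType) (U : finType) (f : {set U} -> rat)
    (v : U -> R) : R :=
  sup [set \sum_u v u * y u | y in polymatroid f].

(* Mutual independence: the product rule for every finite subfamily. *)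
Definition independent_RVs (d : measure_display) (Omega : measurableType d)
    (R : realType) (P : probability Omega R) (U : finType)
    (w : U -> {RV P >-> R}) : Prop :=
  forall (J : {set U}) (B : U -> set R), (forall u, measurable (B u)) ->
    P (\bigcap_(u in [set u | u \in J]) (w u @^-1` B u)) =
    (\prod_(u in J) P (w u @^-1` B u))%E.

(* The elements presented so far with their weights, oldest first. *)
Definition history (R : realType) (U : finType) := seq (U * R).

(* The algorithm maps the history, whose last entry is the element currently
   presented, to the coordinate of that element. Earlier decisions are
   functions of the earlier history and need not be recorded. *)
Definition algorithm (R : realType) (U : finType) := history R U -> R.

(* The adversary maps the history to the next element to present. *)
Definition adversary (R : realType) (U : finType) := history R U -> U.

Definition measurable_algorithm (R : realType) (U : finType)
    (A : algorithm R U) : Prop :=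
  forall (k : nat) (s : k.-tuple U),
    measurable_fun [set: k.-tuple R] (fun t : k.-tuple R => A (zip s t)).

Definition measurable_adversary (R : realType) (U : finType)
    (D : adversary R U) : Prop :=
  forall (k : nat) (s : k.-tuple U) (u : U),
    measurable [set t : k.-tuple R | D (zip s t) = u].

Definition presents_new_elements (R : realType) (U : finType)
    (D : adversary R U) : Prop :=
  forall h : history R U, uniq (unzip1 h) -> (size h < #|U|)%N ->
    D h \notin unzip1 h.

(* The history after k rounds when the weights are v. *)
Fixpoint run (R : realType) (U : finType) (D : adversary R U) (v : U -> R)
    (k : nat) : history R U :=
  if k is k'.+1 then
    let h := run D v k' in rcons h (D h, v (D h))
  else [::].

(* Coordinate u is fixed by the algorithm from the part of the full history
   that ends with the presentation of u. *)
Definition output (R : realType) (U : finType) (A : algorithm R U)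
    (D : adversary R U) (v : U -> R) : U -> R :=
  fun u => let h := run D v #|U| in A (take (index u (unzip1 h)).+1 h).

Section run_facts.
Context (R : realType) (U : finType) (D : adversary R U) (v : U -> R).
Hypothesis newD : presents_new_elements D.

Lemma run_uniq k : (k <= #|U|)%N ->
  size (run D v k) = k /\ uniq (unzip1 (run D v k)).
Proof.
elim: k => [//|k IHk] ltkU /=; have [sz un] := IHk (ltnW ltkU).
rewrite size_rcons sz /unzip1 map_rcons rcons_uniq un andbT; split=> //.
by apply: newD; rewrite ?sz.
Qed.

Lemma mem_run u : u \in unzip1 (run D v #|U|).
Proof.
have [sz un] := run_uniq (leqnn _).
have := card_uniqP un; rewrite size_map sz => /esym/eqP.
have sub : {subset unzip1 (run D v #|U|) <= U} by [].
by rewrite eq_sym => /eqP/(subset_cardP)/(_ (subset_predT _))->.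
Qed.

End run_facts.

Section optimum.
Context (R : realType) (U : finType) (f : {set U} -> rat).
Hypothesis f_ge0 : forall S, 0 <= f S.

Lemma polymatroid0 : polymatroid f (fun _ : U => 0 : R).
Proof.
split=> // T; rewrite big1 // ler0q; exact: f_ge0.
Qed.

Lemma polymatroid_compact :
  compact (polymatroid f : set (prod_topology (fun _ : U => R))).
Proof.
pose K := [set z : prod_topology (fun _ : U => R) |
  forall u, `[0, ratr (f [set u]%SET)]%classic (z u)].
have cK : compact K.
  apply: (@tychonoff U (fun=> R) (fun u => `[0, ratr (f [set u]%SET)]%classic)).
  by move=> u; exact: segment_compact.
apply: (subclosed_compact _ cK); last first.
  move=> z [z0 zf] u /=; rewrite in_itv /= z0 /=.
  by have := zf [set u]%SET; rewrite big_set1.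
have -> : (polymatroid f : set (prod_topology (fun _ : U => R))) =
    \bigcap_(u in [set: U]) (proj u @^-1` [set x : R | 0 <= x]) `&`
    \bigcap_(T in [set: {set U}])
      ((fun z : prod_topology (fun _ : U => R) => \sum_(u in T) proj u z)
        @^-1` [set x : R | x <= ratr (f T)]).
  apply/seteqP; split=> z [z0 zf].
    by split=> [u _|T _]; [exact: z0 | exact: zf].
  by split=> [u|T]; [exact: (z0 u I) | exact: (zf T I)].
apply: closedI; apply: closed_bigI => i _.
- apply: preimage_closed; last exact: closed_ge.
  by move=> z _; exact: proj_continuous.
- apply: preimage_closed; last exact: closed_le.
  move=> z _; apply: continuous_big => [|u _]; first exact: add_continuous.
  exact: proj_continuous.
Qed.

Lemma max_weightP (v : U -> R) :
  exists2 y, polymatroid f y & max_weight f v = \sum_u v u * y u /\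
    forall z, polymatroid f z -> \sum_u v u * z u <= \sum_u v u * y u.
Proof.
pose g (z : prod_topology (fun _ : U => R)) : R := \sum_u v u * proj u z.
have cg : continuous g.
  apply: (@continuous_big _ _ _ _ _ _ _ _
    (fun u (z : prod_topology (fun _ : U => R)) => v u * proj u z)) => [|u _ z].
    exact: add_continuous.
  apply: (@continuous_comp (prod_topology (fun _ : U => R)) R R
    (proj u) (fun x : R => v u * x)).
    exact: proj_continuous.
  exact: mulrl_continuous.
have cf := continuous_subspaceT cg.
have [|y] := compact_EVT_max _ polymatroid_compact (cf _).
  by exists (fun=> 0); exact: polymatroid0.
rewrite inE => yP ymax.
have ub z : polymatroid f z -> \sum_u v u * z u <= \sum_u v u * y u.
  by move=> zP; apply: ymax; rewrite inE.
exists y => //; split=> //; apply/eqP; rewrite eq_le; apply/andP; split.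
  apply: ge_sup; first by exists (\sum_u v u * y u), y.
  by move=> _ [z zP <-]; exact: ub.
apply: ub_le_sup; last by exists y.
by exists (\sum_u v u * y u) => _ [z zP <-]; exact: ub.
Qed.

Lemma max_weight_monotone (v : U -> R) : (forall u, 0 <= v u) ->
  (forall S T : {set U}, S \subset T -> f S <= f T) ->
  max_weight f v = sup [set \sum_u v u * y u | y in
    [set y : U -> R | forall T : {set U}, \sum_(u in T) y u <= ratr (f T)]].
Proof.
move=> v0 mf; have [y yP [-> ymax]] := max_weightP v.
have ub z : (forall T : {set U}, \sum_(u in T) z u <= ratr (f T)) ->
    \sum_u v u * z u <= \sum_u v u * y u.
  move=> zf; pose z' u := Num.max 0 (z u).
  apply: (@le_trans _ _ (\sum_u v u * z' u)).
    by apply: ler_sum => u _; rewrite ler_wpM2l// le_max lexx orbT.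
  apply: ymax; split=> [u|T]; first by rewrite le_max lexx.
  pose T' := [set u in T | 0 <= z u]%SET.
  have -> : \sum_(u in T) z' u = \sum_(u in T') z u.
    rewrite (bigID (fun u => 0 <= z u)) /= [X in _ + X]big1 ?addr0; last first.
      by move=> u /andP[_]; rewrite -ltNge => /ltW zu; exact/max_idPl.
    by apply: eq_big => [u|u /andP[_ zu]]; [rewrite inE | exact/max_idPr].
  apply: le_trans (zf T') _; rewrite ler_rat mf //.
  by apply/fintype.subsetP => u; rewrite inE => /andP[].
have yE : [set \sum_u v u * y u | y in [set y : U -> R |
    forall T : {set U}, \sum_(u in T) y u <= ratr (f T)]] (\sum_u v u * y u).
  by exists y => //; case: yP.
apply/eqP; rewrite eq_le; apply/andP; split.
  by apply: ub_le_sup => //; exists (\sum_u v u * y u) => _ [z zP <-]; exact: ub.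
by apply: ge_sup => [|_ [z zP <-]]; [exists (\sum_u v u * y u) | exact: ub].
Qed.

End optimum.

(* Main.v *)
Require Import Defs.
From HB Require Import structures.
From mathcomp Require Import all_boot all_order all_algebra.
From mathcomp Require Import all_classical all_reals all_analysis.
From mathcomp Require Import measurable_realfun.
From mathcomp Require Import zify lra.

(* Scale f by a common denominator N to get an integral submodular F and fix
   coordinates on the grid (1/N)Z only. Let V_v(z) be the optimal weight, for
   the weights v, of a vector that can be added to z inside the polymatroid, and
   W(z) its expectation. When u with weight a arrives at z, the algorithm
   maximizes a t + W(z + t e_u) / 2. The payoff is thus half of W(0) - W(z_n),
   where z_n is the final vector, plus the utilities gained over t = 0. The
   state and the choice of u do not depend on the weight of u, so in
   expectation this weight may be replaced by an independent copy, which is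
   compared with the optimal vector y that can be added to z_n. The cost of
   the coordinates of y is controlled by diminishing returns,
   V_v(z) - V_v(z + a) <= V_v(z') - V_v(z' + a) for z <= z', so that the
   expected utilities pay for the remaining W(z_n) / 2. Diminishing returns
   hold because V_v(z) is a fixed nonnegative combination of the functions
   z |-> min over S containing L of F(S) - z(S).
   If W(0) is infinite, a fixed vector of the polymatroid that is positive on
   all usable elements has infinite expected weight. *)

Set Implicit Arguments.
Unset Strict Implicit.
Unset Printing Implicit Defensive.

Import Order.TTheory GRing.Theory Num.Theory.
Import numFieldNormedType.Exports.

Local Open Scope classical_set_scope.
Local Open Scope ring_scope.

(** * Integral polymatroids: slacks, tight sets and level sets *)

Section integral_polymatroid.
Context (U : finType) (F : {set U} -> nat).
Hypothesis submodF :
  forall X Y, (F (X :&: Y)%SET + F (X :|: Y)%SET <= F X + F Y)%N.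
Implicit Types (z y a : U -> nat) (S T L : {set U}).

Definition vsum z T : nat := (\sum_(u in T) z u)%N.

Definition vadd z a : U -> nat := fun u => (z u + a u)%N.

Definition feasible z : bool := [forall T, (vsum z T <= F T)%N].

(** The truncated subtraction is exact when [z] is feasible. *)
Definition slack z S : nat := (F S - vsum z S)%N.

(** For feasible [z] and nonempty [L] this is the largest total that can still be added on [L], that
    is, the rank of [L] in the polymatroid contracted by [z]. The full set serves as the default of
    the minimum, since it contains every [L]. *)
Definition residual z L : nat :=
  slack z [arg min_(S < [set: U]%SET | L \subset S) slack z S]%N.

Lemma vsum_add z a T : vsum (vadd z a) T = (vsum z T + vsum a T)%N.
Proof. exact: big_split. Qed.

Lemma vsum_modular z S T :
  (vsum z (S :&: T)%SET + vsum z (S :|: T)%SET = vsum z S + vsum z T)%N.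
Proof.
have vsumE X : vsum z X = (\sum_u z u * (u \in X))%N.
  rewrite /vsum big_mkcond; apply: eq_bigr => u _.
  by case: ifP; rewrite ?muln1 ?muln0.
rewrite !vsumE -!big_split; apply: eq_bigr => u _; rewrite !inE.
by case: (u \in S); case: (u \in T); rewrite /= ?muln0 ?muln1 ?addn0 ?add0n.
Qed.

Lemma vsum_subset z S T : S \subset T -> (vsum z S <= vsum z T)%N.
Proof.
move=> sST; rewrite /vsum [leqRHS](big_setID S) /= (finset.setIidPr sST); lia.
Qed.

Lemma leq_vsum z a T : (forall u, z u <= a u)%N -> (vsum z T <= vsum a T)%N.
Proof. by move=> za; exact: leq_sum. Qed.

Lemma feasibleP z : reflect (forall T, (vsum z T <= F T)%N) (feasible z).
Proof. exact: forallP. Qed.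

Lemma feasible_le z a : (forall u, z u <= a u)%N -> feasible a -> feasible z.
Proof.
move=> za /feasibleP fa; apply/feasibleP => T.
exact: leq_trans (leq_vsum _ za) (fa T).
Qed.

Lemma residual_le z L S : L \subset S -> (residual z L <= slack z S)%N.
Proof.
rewrite /residual; case: arg_minnP => [|S' _ min_S']; last exact: min_S'.
exact: finset.subsetT.
Qed.

Lemma residual_attained z L :
  exists2 S : {set U}, L \subset S & residual z L = slack z S.
Proof.
rewrite /residual; case: arg_minnP => [|S sLS _]; first exact: finset.subsetT.
by exists S.
Qed.

(** Uncrossing: if [S] is a minimizer for [vadd z a] and [T] one for [z'], then the intersection is
    a candidate for [z] and the union a candidate for [vadd z' a]. Submodularity bounds the values
    of [F]. The surplus [z' - z] on [T] and the amount [a] on [S] are both counted in the union. *)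
Lemma residual_diminishing z z' a L :
  (forall u, z u <= z' u)%N -> feasible (vadd z' a) ->
  (residual z L + residual (vadd z' a) L <=
   residual (vadd z a) L + residual z' L)%N.
Proof.
move=> zz' fz'a.
have fza : feasible (vadd z a).
  by apply: feasible_le fz'a => u; rewrite leq_add2r.
have [S sLS ->] := residual_attained (vadd z a) L.
have [T sLT ->] := residual_attained z' L.
have sLI : L \subset (S :&: T)%SET by rewrite finset.subsetI sLS.
have sLU : L \subset (S :|: T)%SET.
  by apply: fintype.subset_trans sLS (finset.subsetUl _ _).
have := residual_le z sLI; have := residual_le (vadd z' a) sLU.
pose b u := (z' u - z u)%N.
have zE X : vsum z' X = (vsum z X + vsum b X)%N.
  by rewrite -vsum_add; apply: eq_bigr => u _; rewrite /vadd subnKC.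
have bU := vsum_subset b (finset.subsetUr S T).
have aU := vsum_subset a (finset.subsetUl S T).
have zIU := vsum_modular z S T; have FIU := submodF S T.
move/feasibleP: fz'a => fz'a; move/feasibleP: fza => fza.
move: (fz'a (S :|: T)%SET) (fz'a (S :&: T)%SET) (fz'a T).
move: (fza S) (fza (S :&: T)%SET).
rewrite /slack !vsum_add !zE; lia.
Qed.

Lemma tightU z S T : feasible z -> vsum z S = F S -> vsum z T = F T ->
  vsum z (S :|: T)%SET = F (S :|: T)%SET.
Proof.
move=> /feasibleP fz zS zT; have := vsum_modular z S T; have := submodF S T.
have := fz (S :&: T)%SET; have := fz (S :|: T)%SET; lia.
Qed.

(** By [tightU], a largest tight set through one element of [L] absorbs every tight set through
    another. Some element is required to start from, as the empty set is tight only if [F] vanishes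
    there. *)
Lemma tight_cover z L : feasible z -> L != finset.set0 ->
  (forall u, u \in L -> exists2 S : {set U}, u \in S & vsum z S = F S) ->
  exists2 S : {set U}, L \subset S & vsum z S = F S.
Proof.
move=> fz /finset.set0Pn[u0 Lu0] tight.
have [S0 S0u0 tS0] := tight _ Lu0.
have [|S /andP[Su0 /eqP tS] maxS] :=
    @arg_maxnP _ S0 [pred S : {set U} | (u0 \in S) && (vsum z S == F S)]
      (fun S : {set U} => #|S|).
  by rewrite /= S0u0 tS0 eqxx.
exists S => //; apply/fintype.subsetP => u /tight[T Tu tT].
have leU : (#|(S :|: T)%SET| <= #|S|)%N.
  by apply: maxS; rewrite /= inE Su0 /= tightU.
have /eqP-> : S == (S :|: T)%SET by rewrite eqEcard finset.subsetUl.
by rewrite inE Tu orbT.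
Qed.

(** A coordinate of [L] that lies in no tight set can be raised by one. When no such coordinate is
    left, [tight_cover] applies. Each raise uses up room below [F] of the full set, so the process
    ends. *)
Lemma extend_tight z y L : L != finset.set0 -> feasible (vadd z y) ->
  (forall u, u \notin L -> y u = 0%N) ->
  exists y', [/\ forall u, (y u <= y' u)%N, feasible (vadd z y'),
    forall u, u \notin L -> y' u = 0%N &
    exists2 S : {set U}, L \subset S & vsum (vadd z y') S = F S].
Proof.
move=> L0; have [n] := ubnP (F finset.setT - vsum (vadd z y) finset.setT)%N.
elim: n y => // n IHn y len fzy y0.
have [tight|] := pselect (forall u, u \in L ->
    exists2 S : {set U}, u \in S & vsum (vadd z y) S = F S).
  by exists y; split=> //; exact: tight_cover.
move=> /existsNP[u /not_implyP[Lu /forall2NP ntight]].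
pose y1 v := (y v + (v == u))%N.
have y1E T : vsum (vadd z y1) T = (vsum (vadd z y) T + (u \in T))%N.
  transitivity (vsum (vadd (vadd z y) (fun v => nat_of_bool (v == u))) T).
    by apply: eq_bigr => v _; rewrite /vadd /y1 addnA.
  rewrite vsum_add; congr addn; rewrite /vsum.
  have [Tu|Tu] := boolP (u \in T).
    by rewrite (bigD1 u) //= eqxx big1 ?addn0 // => v /andP[_ /negPf->].
  by rewrite big1 // => v Tv; case: eqP Tv => // ->; rewrite (negPf Tu).
have fzy1 : feasible (vadd z y1).
  apply/feasibleP => T; rewrite y1E; have := feasibleP _ fzy T.
  by case: (ntight T) => [/negP/negPf->|/eqP]; lia.
have := feasibleP _ fzy1 finset.setT; rewrite y1E inE => ltF.
have [|//|v Lv|y' [yy' fy' y'0 tight]] := IHn y1.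
- by rewrite y1E inE; lia.
- by rewrite /y1 y0 //; case: eqP Lv => // ->; rewrite Lu.
- by exists y'; split=> // v; apply: leq_trans (yy' v); rewrite /y1; lia.
Qed.

(** The smallest positive weight is peeled off the support of [v], which writes [v] as a combination
    of indicators of nested level sets. The last clause is the greedy algorithm: the vector that
    serves the inner levels is extended inside [L] until a tight set covers [L]. Extending never
    lowers a coordinate, so the bounds for the inner levels persist. *)
Lemma level_decomposition (R : realDomainType) (v : U -> R) :
  (forall u, 0 <= v u) ->
  exists s : seq (R * {set U}),
  [/\ forall p, p \in s -> 0 <= p.1,
      forall u, v u = \sum_(p <- s) p.1 * (u \in p.2)%:R &
      forall z, feasible z -> exists y,
        [/\ feasible (vadd z y), forall u, v u = 0 -> y u = 0%N &
            forall p, p \in s -> (residual z p.2 <= vsum y p.2)%N]].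
Proof.
have [n] := ubnP #|[set u | v u != 0]%SET|.
elim: n v => // n IHn v; set L := [set u | v u != 0]%SET => ltn v0.
have [L0|L0] := eqVneq L finset.set0.
  exists [::]; split=> // [u|z fz].
    by have := finset.in_set0 u; rewrite -L0 inE big_nil => /negbFE/eqP.
  exists (fun=> 0%N); split=> //.
  by apply: feasible_le fz => u; rewrite /vadd addn0.
have /finset.set0Pn[u0 Lu0] := L0.
pose u1 := [arg min_(u < u0 in L) v u]%O.
have [Lu1 u1min] : u1 \in L /\ forall u, u \in L -> v u1 <= v u.
  by rewrite /u1; case: arg_minP.
pose v' u := if u \in L then v u - v u1 else 0.
have v'0 u : 0 <= v' u by rewrite /v'; case: ifP => // /u1min; rewrite subr_ge0.
have [|s [s0 sE sy]] := IHn v' _ v'0.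
  have: ([set u | v' u != 0]%SET \proper L).
    apply/properP; split; last first.
      by exists u1 => //; rewrite inE /v' Lu1 subrr eqxx.
    by apply/fintype.subsetP => u; rewrite inE /v'; case: ifP; rewrite ?eqxx.
  by move/proper_card/leq_trans; apply.
exists ((v u1, L) :: s); split=> [p|u|z fz].
- by rewrite inE => /predU1P[->|/s0 //]; exact: v0.
- rewrite big_cons -sE /v' /=; case: ifPn => Lu.
    by rewrite mulr1 addrC subrK.
  by move: Lu; rewrite inE negbK => /eqP->; rewrite mulr0 addr0.
- have [y [fy y0 ys]] := sy z fz.
  have [u Lu|y' [yy' fy' y'0 [S sLS tS]]] := extend_tight L0 fy.
    by apply: y0; rewrite /v' (negPf Lu).
  exists y'; split=> // [u vu|p].
    by apply: y'0; rewrite inE vu eqxx.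
  rewrite inE => /orP[/eqP->|/ys ps] /=; last first.
    exact: leq_trans ps (leq_vsum _ yy').
  (* As [S] is tight and [y'] vanishes outside [L], the slack of [z] at [S] is the sum of [y'] over
     [L]. *)
  apply: leq_trans (residual_le z sLS) _.
  rewrite /slack -tS vsum_add addKn /vsum (big_setID L) /=.
  rewrite (finset.setIidPr sLS).
  by rewrite [X in (_ + X)%N]big1 ?addn0 // => u; rewrite inE => /andP[/y'0].
Qed.

(** * The optimal weight on the grid and its diminishing returns *)

Section optimum.
Context (R : realType).
Implicit Types v : U -> R.

Definition capacity : nat := (\max_(T : {set U}) F T)%N.

Definition dot v y : R := \sum_u v u * (y u)%:R.

(** A maximum over a finite type: by [feasible_capacity], bounding the coordinates by [capacity]
    excludes no feasible vector. *)
Definition opt v z : R :=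
  \big[Order.max/0]_(y : {ffun U -> 'I_capacity.+1} |
    feasible (vadd z (fun u => y u))) dot v (fun u => y u).

Lemma feasible_capacity z u : feasible z -> (z u <= capacity)%N.
Proof.
move=> /feasibleP/(_ [set u]%SET); rewrite /vsum finset.big_set1.
move=> /leq_trans; apply.
exact: leq_bigmax.
Qed.

Lemma as_state y : (forall u, y u <= capacity)%N ->
  exists t : {ffun U -> 'I_capacity.+1}, y = (fun u => nat_of_ord (t u)).
Proof.
move=> yc; exists [ffun u => inord (y u)]; apply/funext => u.
by rewrite ffunE inordK // ltnS.
Qed.

Lemma opt_ge v z y : feasible (vadd z y) -> dot v y <= opt v z.
Proof.
move=> fzy; have [|t yE] := @as_state y.
  move=> u; apply: feasible_capacity; apply: feasible_le fzy => u'.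
  exact: leq_addl.
subst y; exact: (le_bigmax_cond _
  (fun t : {ffun U -> 'I_capacity.+1} => dot v (fun u => t u))).
Qed.

Lemma opt_ge0 v z : 0 <= opt v z.
Proof. exact: bigmax_ge_id. Qed.

Lemma dot_ge0 v y : (forall u, 0 <= v u) -> 0 <= dot v y.
Proof. by move=> v0; apply: sumr_ge0 => u _; rewrite mulr_ge0. Qed.

Lemma opt_attained v z : (forall u, 0 <= v u) -> feasible z ->
  exists2 y, feasible (vadd z y) & opt v z = dot v y.
Proof.
move=> v0 fz; pose t0 : {ffun U -> 'I_capacity.+1} := [ffun=> ord0].
have ft0 : feasible (vadd z (fun u => t0 u)).
  by apply: feasible_le fz => u; rewrite /vadd ffunE addn0.
rewrite /opt (bigmax_eq_arg _ t0) //; last by move=> t _; exact: dot_ge0.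
by case: arg_maxP => // t ft _; exists (fun u => nat_of_ord (t u)).
Qed.

Lemma weighted_level_sum v (s : seq (R * {set U})) (x : U -> R) :
  (forall u, v u = \sum_(p <- s) p.1 * (u \in p.2)%:R) ->
  \sum_u v u * x u = \sum_(p <- s) p.1 * \sum_(u in p.2) x u.
Proof.
move=> vE; under eq_bigr => u _ do rewrite vE mulr_suml.
rewrite exchange_big /=; apply: eq_bigr => p _.
rewrite mulr_sumr [RHS]big_mkcond /=; apply: eq_bigr => u _.
by case: ifP; rewrite ?mulr1 ?mulr0 ?mul0r.
Qed.

(** The decomposition [s] is the same for all [z], so inequalities between residuals pass to [opt].
    No addable vector exceeds the residual of any level set, and the greedy vector reaches all of
    these residuals at once. *)
Lemma opt_residual v : (forall u, 0 <= v u) ->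
  exists s : seq (R * {set U}),
  [/\ forall p, p \in s -> 0 <= p.1,
      forall u, v u = \sum_(p <- s) p.1 * (u \in p.2)%:R &
      forall z, feasible z ->
        opt v z = \sum_(p <- s) p.1 * (residual z p.2)%:R].
Proof.
move=> v0; have [s [s0 vE sy]] := level_decomposition v0.
exists s; split=> // z fz; apply/eqP; rewrite eq_le; apply/andP; split.
- have [y fy ->] := opt_attained v0 fz.
  rewrite /dot (weighted_level_sum _ vE) big_seq [leRHS]big_seq.
  apply: ler_sum => p ps; rewrite ler_wpM2l ?s0 // -natr_sum ler_nat.
  have [S sS ->] := residual_attained z p.2.
  apply: leq_trans (vsum_subset y sS) _.
  have := feasibleP _ fy S; rewrite /slack vsum_add; lia.
- have [y [fy _ ys]] := sy z fz; apply: le_trans (opt_ge v fy).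
  rewrite /dot (weighted_level_sum _ vE) big_seq [leRHS]big_seq.
  by apply: ler_sum => p ps; rewrite ler_wpM2l ?s0 // -natr_sum ler_nat ys.
Qed.

Lemma opt_diminishing v z z' a : (forall u, 0 <= v u) ->
  (forall u, z u <= z' u)%N -> feasible (vadd z' a) ->
  opt v z + opt v (vadd z' a) <= opt v (vadd z a) + opt v z'.
Proof.
move=> v0 zz' fz'a; have [s [s0 _ optE]] := opt_residual v0.
have fz' : feasible z' by apply: feasible_le fz'a => u; exact: leq_addr.
have fz : feasible z by exact: feasible_le fz'.
have fza : feasible (vadd z a).
  by apply: feasible_le fz'a => u; rewrite leq_add2r.
rewrite !optE // -!big_split /= big_seq [leRHS]big_seq; apply: ler_sum => p ps.
by rewrite -!mulrDr ler_wpM2l ?s0 // -!natrD ler_nat residual_diminishing.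
Qed.

Lemma opt_antitone v z z' : (forall u, z u <= z' u)%N -> opt v z' <= opt v z.
Proof.
move=> zz'; apply: bigmax_le => [|y fy]; first exact: opt_ge0.
by apply: opt_ge; apply: feasible_le fy => u; rewrite leq_add2r.
Qed.

(* The grid optimum is the optimum over all real vectors, because the greedy
   solution of an integral polymatroid is integral. *)
Lemma max_weight_opt (f : {set U} -> rat) (N : nat) v :
  (0 < N)%N -> (forall S, ratr (f S) = (F S)%:R / N%:R :> R) ->
  (forall u, 0 <= v u) -> max_weight f v = opt v (fun=> 0%N) / N%:R.
Proof.
move=> N0 fE v0.
have f0 S : 0 <= f S by rewrite -(ler0q R) fE divr_ge0.
have fz0 : feasible (fun=> 0%N) by apply/feasibleP => T; rewrite /vsum big1.
have [y [y0 yf] [-> ymax]] := max_weightP f0 v.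
have N0' : 0 < N%:R :> R by rewrite ltr0n.
apply/eqP; rewrite eq_le; apply/andP; split.
- have [s [s0 vE ->]] := opt_residual v0 => //.
  rewrite (weighted_level_sum _ vE) mulr_suml big_seq [leRHS]big_seq.
  apply: ler_sum => p ps; rewrite -mulrA ler_wpM2l ?s0 //.
  have [S sS ->] := residual_attained (fun=> 0%N) p.2.
  rewrite /slack (_ : vsum _ _ = 0%N) ?subn0 -?fE; last exact: big1.
  apply: le_trans (yf S).
  rewrite [leRHS](big_setID p.2) /= (finset.setIidPr sS) lerDl.
  exact: sumr_ge0.
- have [y' fy' ->] := opt_attained v0 fz0.
  have /ymax : polymatroid f (fun u => (y' u)%:R / N%:R :> R).
    split=> [u|T]; first by rewrite divr_ge0.
    rewrite fE -mulr_suml ler_pM2r ?invr_gt0 // -natr_sum ler_nat.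
    exact: (feasibleP _ fy' T).
  apply: le_trans; rewrite mulr_suml; apply: ler_sum => u _.
  by rewrite mulrA.
Qed.

End optimum.
End integral_polymatroid.

(** * Boxes as a generating pi-system for tuples *)

Section tuple_boxes.
Context (d : measure_display) (T : measurableType d) (k : nat).

Definition boxes : set (set (k.-tuple T)) :=
  [set A | exists2 B : 'I_k -> set T, (forall i, measurable (B i)) &
    A = [set t | forall i, B i (tnth t i)]].

Lemma boxT : boxes setT.
Proof. by exists (fun=> setT) => //; apply/seteqP; split. Qed.

Lemma boxes_setI_closed : setI_closed boxes.
Proof.
move=> _ _ [A mA ->] [B mB ->]; exists (fun i => A i `&` B i).
  by move=> i; exact: measurableI.
by apply/seteqP; split=> [t [tA tB] i //|t tAB]; split=> i; case: (tAB i).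
Qed.

Lemma measurable_tuple_boxes : measurable = <<s boxes >>.
Proof.
apply/seteqP; split.
- apply: smallest_sub; first exact: smallest_sigma_algebra.
  rewrite -bigcup_seq; apply: bigcup_sub => i _ _ [B mB <-].
  apply: sub_sigma_algebra; exists (fun j => if j == i then B else setT).
    by move=> j; case: ifP.
  apply/seteqP; split=> [t [_ Bt] j|t Bt]; first by case: eqP => [->|].
  by split=> //; have := Bt i; rewrite eqxx.
- apply: smallest_sub; first exact: sigma_algebra_measurable.
  move=> _ [B mB ->].
  have -> : [set t : k.-tuple T | forall i, B i (tnth t i)] =
      \bigcap_(i in [set: 'I_k]) ((@tnth k T ^~ i) @^-1` B i).
    by apply/seteqP; split=> [t Bt i _|t Bt i]; [exact: Bt|exact: (Bt i I)].
  apply: fin_bigcap_measurable => // i _.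
  by rewrite -[_ @^-1` _]setTI; exact: measurable_tnth.
Qed.

End tuple_boxes.

(** * Independence of one weight from a tuple of other weights *)

Section independence.
Context (d : measure_display) (Omega : measurableType d) (R : realType).
Context (P : probability Omega R) (U : finType) (w : U -> {RV P >-> R}).
Hypothesis indep : independent_RVs w.
Context (k : nat) (s : k.-tuple U) (u : U).
Hypothesis us_uniq : uniq (u :: s).

Definition weights (x : Omega) : k.-tuple R := map_tuple (fun u' => w u' x) s.

Lemma measurable_weights : measurable_fun [set: Omega] weights.
Proof.
apply/measurable_fun_tnthP => i.
rewrite (_ : _ \o _ = w (tnth s i)); first exact: measurable_funP.
by apply/funext => x /=; rewrite tnth_map.
Qed.

Lemma independent_boxes (A : set (k.-tuple R)) (B : set R) :
  boxes A -> measurable B ->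
  P (weights @^-1` A `&` w u @^-1` B) =
  (P (weights @^-1` A) * P (w u @^-1` B))%E.
Proof.
move=> [C mC ->] mB; move: us_uniq => /= /andP[us uniqs].
(* [E] gives each entry of [s] its side of the box and every other element, in particular [u], the
   set [B]. This is consistent because [u :: s] has no repetition. *)
pose E v : set R := if insub (index v s) is Some i then C i else B.
have mE v : measurable (E v) by rewrite /E; case: insubP.
have Es i : E (tnth s i) = C i.
  rewrite /E (tnth_nth u) index_uniq ?size_tuple //.
  by rewrite insubT // => lti; congr C; exact: val_inj.
have Eu : E u = B.
  rewrite /E insubF // -{2}(size_tuple s) index_mem; exact: negbTE.
have boxE : weights @^-1` [set t | forall i, C i (tnth t i)] =
    \bigcap_(v in [set v | v \in [set v in s]%SET]) (w v @^-1` E v).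
  apply/seteqP; split=> [x Cx v|x Ex i] /=.
    rewrite inE => /tnthP[i ->]; rewrite Es.
    by have := Cx i; rewrite tnth_map.
  by rewrite tnth_map -Es; apply: Ex; rewrite /= inE mem_tnth.
have boxuE : weights @^-1` [set t | forall i, C i (tnth t i)] `&` w u @^-1` B =
    \bigcap_(v in [set v | v \in u |: [set v in s]%SET]) (w v @^-1` E v).
  rewrite boxE; apply/seteqP; split=> [x [Ex Bx] v|x Ex].
    rewrite /= !inE => /predU1P[->|vs]; first by rewrite Eu.
    by apply: Ex; rewrite /= inE.
  split; first by move=> v vs; apply: Ex; rewrite /= inE vs orbT.
  by rewrite -Eu; apply: Ex; rewrite /= !inE eqxx.
rewrite boxuE boxE !indep // big_setU1 ?inE //= Eu muleC //.
Qed.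

(** For fixed [B] both sides are finite measures in [A]. They agree on the boxes, hence
    everywhere. *)
Lemma independent_weights (A : set (k.-tuple R)) (B : set R) :
  measurable A -> measurable B ->
  P (weights @^-1` A `&` w u @^-1` B) =
  (P (weights @^-1` A) * P (w u @^-1` B))%E.
Proof.
move=> mA mB.
have mwB : measurable (w u @^-1` B) by exact: measurable_funPTI.
have p0 : 0 <= fine (P (w u @^-1` B)) by exact: fine_ge0.
have := @measure_unique _ R (k.-tuple R) (@boxes _ R k) (fun=> setT)
  (measurable_tuple_boxes R k) (@boxes_setI_closed _ R k) (fun=> boxT R k)
  _ (pushforward (mrestr P mwB) weights)
  (mscale (NngNum p0) (pushforward P weights)).
move=> /(_ _ measurable_weights measurable_weights _ _ A mA) /=.
rewrite /pushforward /mrestr /mscale /= => -> //.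
- by rewrite fineK ?fin_num_measure // muleC.
- by rewrite bigcup_const.
- by move=> C bC; rewrite fineK ?fin_num_measure // muleC independent_boxes.
- by move=> _; rewrite preimage_setT setTI ltey_eq fin_num_measure.
Qed.

(** Both sides are integrals of [g] over the line: against the law of [w u] restricted to the event,
    and against the full law scaled by the probability of the event. By [independent_weights] these
    measures coincide. *)
Lemma independent_integral (A : set (k.-tuple R)) (g : R -> R) :
  measurable A -> measurable_fun setT g -> (forall r, 0 <= g r) ->
  (\int[P]_(x in weights @^-1` A) (g (w u x))%:E =
   P (weights @^-1` A) * \int[P]_x (g (w u x))%:E)%E.
Proof.
move=> mA mg g0.
have mwA : measurable (weights @^-1` A).
  by rewrite -[_ @^-1` _]setTI; exact: measurable_weights.
have p0 : 0 <= fine (P (weights @^-1` A)) by exact: fine_ge0.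
have mgE : measurable_fun setT (EFin \o g) by exact/measurable_EFinP.
have mgw : measurable_fun setT (fun x => (g (w u x))%:E).
  by apply/measurable_EFinP; exact: measurableT_comp.
transitivity (\int[pushforward (mrestr P mwA) (w u)]_r (g r)%:E)%E.
  rewrite ge0_integral_pushforward //= ?preimage_setT; last first.
    by move=> r _; rewrite lee_fin.
  rewrite (@ge0_negligible_integral _ _ _ (mrestr P mwA) _
    (~` (weights @^-1` A))) //.
  - rewrite setTD setCK; apply: eq_measure_integral => B mB BA.
    by rewrite /= /mrestr setIidl.
  - exact: measurableC.
  - by move=> x _; rewrite lee_fin.
  - by rewrite /= /mrestr setICl measure0.
transitivity (\int[mscale (NngNum p0) (distribution P (w u))]_r (g r)%:E)%E.
  apply: eq_measure_integral => B mB _.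
  transitivity (P (weights @^-1` A) * P (w u @^-1` B))%E.
    by rewrite -independent_weights // setIC.
  by rewrite -[in LHS](fineK (fin_num_measure P _ mwA)).
rewrite ge0_integral_mscale //=; last by move=> r _; rewrite lee_fin.
rewrite ge0_integral_distribution //.
by rewrite fineK ?fin_num_measure.
Qed.

End independence.

(** * Maps to finite types, measurable fibre by fibre *)

Section finite_labels.
Context (d : measure_display) (T : measurableType d).

Definition measurable_label (J : finType) (j : T -> J) : Prop :=
  forall i, measurable (j @^-1` [set i]).

Lemma measurable_label_cst (J : finType) (i : J) : measurable_label (fun=> i).
Proof.
by move=> i'; rewrite preimage_cst; case: ifP.
Qed.

Lemma measurable_label_precomp (d' : measure_display) (V : measurableType d')
    (J : finType) (h : V -> T) (j : T -> J) :
  measurable_fun setT h -> measurable_label j ->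
  forall i, measurable ((j \o h) @^-1` [set i]).
Proof.
by move=> mh mj i; rewrite comp_preimage -[_ @^-1` _]setTI; apply: mh.
Qed.

Lemma measurable_label_bind (J K : finType) (j : T -> J) (g : J -> T -> K) :
  measurable_label j -> (forall i, measurable_label (g i)) ->
  measurable_label (fun x => g (j x) x).
Proof.
move=> mj mg i.
have -> : (fun x => g (j x) x) @^-1` [set i] =
    \bigcup_(l in [set: J]) (j @^-1` [set l] `&` g l @^-1` [set i]).
  by apply/seteqP; split=> [x gi|x [l _ [/= <- //]]]; exists (j x).
by apply: fin_bigcup_measurable => // l _; apply: measurableI;
  [exact: mj|exact: mg].
Qed.

Lemma measurable_label_comp (J K : finType) (j : T -> J) (c : J -> K) :
  measurable_label j -> measurable_label (c \o j).
Proof.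
move=> mj; apply: (@measurable_label_bind J K j (fun i _ => c i)) => // i.
exact: measurable_label_cst.
Qed.

Lemma measurable_label_ffun (K J : finType) (j : T -> K -> J) :
  (forall i, measurable_label (j ^~ i)) ->
  measurable_label (fun x => [ffun i => j x i]).
Proof.
move=> mj c.
have -> : (fun x => [ffun i => j x i]) @^-1` [set c] =
    \bigcap_(i in [set: K]) ((j ^~ i) @^-1` [set c i]).
  apply/seteqP; split=> [x /= <- i _ /=|x /= jx]; first by rewrite ffunE.
  by apply/ffunP => i; rewrite ffunE; exact: (jx i I).
by apply: fin_bigcap_measurable => // i _; exact: mj.
Qed.

Lemma measurable_fun_label (d' : measure_display) (V : measurableType d')
    (J : finType) (j : T -> J) (g : J -> T -> V) :
  measurable_label j -> (forall i, measurable_fun setT (g i)) ->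
  measurable_fun setT (fun x => g (j x) x).
Proof.
move=> mj mg _ B mB; rewrite setTI.
have -> : (fun x => g (j x) x) @^-1` B =
    \bigcup_(i in [set: J]) (j @^-1` [set i] `&` g i @^-1` B).
  by apply/seteqP; split=> [x Bx|x [i _ [/= <- //]]]; exists (j x).
apply: fin_bigcup_measurable => // i _; apply: measurableI; first exact: mj.
by rewrite -[_ @^-1` _]setTI; exact: mg.
Qed.

(** The fibres of [j] partition the space, and on each of them the index of [g] is constant. *)
Lemma integral_label (R : realType) (mu : {measure set T -> \bar R})
    (J : finType) (j : T -> J) (g : J -> T -> \bar R) :
  measurable_label j -> (forall i, measurable_fun setT (g i)) ->
  (forall i x, 0 <= g i x)%E ->
  (\int[mu]_x g (j x) x = \sum_i \int[mu]_(x in j @^-1` [set i]) g i x)%E.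
Proof.
move=> mj mg g0.
have UT : \big[setU/set0]_(i <- enum J) (j @^-1` [set i]) = setT.
  rewrite -bigcup_seq; apply/seteqP; split=> // x _; exists (j x) => //=.
  by rewrite mem_enum.
rewrite -{1}UT ge0_integral_bigsetU ?enum_uniq //.
- rewrite -big_enum /=; apply: eq_bigr => i _; apply: eq_integral => x.
  by rewrite inE /= => ->.
- apply/trivIsetP => i i' _ _ ii'.
  by apply/seteqP; split=> // x [/= ->]; exact/eqP.
- by rewrite UT; exact: measurable_fun_label.
Qed.

Lemma measurable_bigmaxr (R : realType) (I : Type) (s : seq I) (Q : pred I)
    (g : I -> T -> R) : (forall i, measurable_fun setT (g i)) ->
  measurable_fun setT (fun x => \big[Order.max/0]_(i <- s | Q i) g i x).
Proof.
move=> mg; elim: s => [|i s IHs].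
  by under eq_fun do rewrite big_nil; exact: measurable_cst.
under eq_fun do rewrite big_cons; case: (Q i) => //.
exact: measurable_maxr.
Qed.

End finite_labels.

(** * Reading one coordinate of the output *)

Section last_element.
Context (R : realType) (U : finType).

Definition by_last (g : history R U -> U -> R) : algorithm R U := fun h =>
  if h is p :: h' then g h (last p h').1 else 0.

Lemma by_last_rcons g h p : by_last g (rcons h p) = g (rcons h p) p.1.
Proof. by case: h => [|q h] //=; rewrite last_rcons. Qed.

(** Reduces a coordinate of the output to one call of the algorithm, on the history that ends with
    [u]. As [u] is absent from [h2], later rounds leave its coordinate alone. *)
Lemma output_rcons (A : algorithm R U) (D : adversary R U) (v : U -> R) u :
  presents_new_elements D -> exists h1 a h2,
  [/\ output A D v u = A (rcons h1 (u, a)),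
      run D v #|U| = rcons h1 (u, a) ++ h2 & u \notin unzip1 h2].
Proof.
move=> newD; have [sz un] := run_uniq v newD (leqnn _).
have hu := mem_run v newD u.
rewrite /output; set h := run D v #|U| in sz un hu *.
set i := index u (unzip1 h).
have ltih : (i < size h)%N by rewrite -(size_map fst) index_mem.
have hE : take i.+1 h = rcons (take i h) (u, (nth (u, 0) h i).2).
  rewrite (take_nth (u, 0)) //; congr rcons.
  rewrite [LHS]surjective_pairing; congr pair.
  by rewrite -(nth_map _ u) // nth_index.
exists (take i h), (nth (u, 0) h i).2, (drop i.+1 h).
rewrite -hE; split=> //; first by rewrite cat_take_drop.
move: un; rewrite -{1}(cat_take_drop i.+1 h) /unzip1 map_cat cat_uniq.
move=> /and3P[_ /hasPn notin _]; apply/negP => /notin /=.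
by rewrite hE map_rcons mem_rcons inE eqxx.
Qed.

End last_element.

(** * The online algorithm and its analysis on a single run, for an arbitrary function [W] *)

Section online.
Context (U : finType) (F : {set U} -> nat) (R : realType).
Context (W : (U -> nat) -> R) (N : nat).

Local Notation state := {ffun U -> 'I_(capacity F).+1}.
Implicit Types (z : state) (u : U) (a : R) (t : 'I_(capacity F).+1).

Definition amounts z : U -> nat := fun u => z u.

Definition update z u t : state := [ffun v => if v == u then t else z v].

(** Zero is always allowed, so that a best amount exists at every state, feasible or not. *)
Definition allowed z u t : bool :=
  (t == ord0) || feasible F (amounts (update z u t)).

Definition gain z u a t : R := a * t%:R + 2^-1 * W (amounts (update z u t)).

Definition best_amount z u a : 'I_(capacity F).+1 :=
  odflt ord0 [pick t | allowed z u t &&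
    [forall t', allowed z u t' ==> (gain z u a t' <= gain z u a t)]].

Definition utility z u a : R :=
  gain z u a (best_amount z u a) - gain z u a ord0.

Definition step z (p : U * R) : state := update z p.1 (best_amount z p.1 p.2).

Definition state_of (h : history R U) : state := foldl step [ffun=> ord0] h.

Definition balanced_algorithm : algorithm R U :=
  by_last (fun h u => (state_of h u)%:R / N%:R).

Lemma best_amountP z u a : allowed z u (best_amount z u a) /\
  forall t, allowed z u t -> gain z u a t <= gain z u a (best_amount z u a).
Proof.
rewrite /best_amount; case: pickP => [t /andP[at_t /forallP max_t]|none] /=.
  by split=> // t' at'; exact: (implyP (max_t t')).
have a0 : allowed z u ord0 by rewrite /allowed eqxx.
have [t at_t max_t] := @arg_maxP _ _ _ ord0 (allowed z u) (gain z u a) a0.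
have := none t; rewrite at_t /= => /negbT/forallPn[t'].
by rewrite negb_imply => /andP[/max_t le_t /negP[]].
Qed.

Lemma utility_ge z u a t : allowed z u t ->
  gain z u a t - gain z u a ord0 <= utility z u a.
Proof. by move=> at_t; rewrite lerD2r; apply: (best_amountP z u a).2. Qed.

Lemma utility_ge0 z u a : 0 <= utility z u a.
Proof.
rewrite -(subrr (gain z u a ord0)); apply: utility_ge.
by rewrite /allowed eqxx.
Qed.

Lemma state_of_rcons h p : state_of (rcons h p) = step (state_of h) p.
Proof. by rewrite /state_of foldl_rcons. Qed.

Lemma amounts_update z u t :
  amounts (update z u t) = (fun v => if v == u then nat_of_ord t else z v).
Proof. by apply/funext => v; rewrite /amounts ffunE; case: eqP. Qed.

Lemma update0 z u : z u = ord0 -> update z u ord0 = z.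
Proof. by move=> zu; apply/ffunP => v; rewrite ffunE; case: eqP => [->|]. Qed.

Lemma state_of_feasible h : feasible F (amounts (state_of h)).
Proof.
elim/last_ind: h => [|h p IHh].
  by apply/feasibleP => T; rewrite /vsum big1 // => u _; rewrite /amounts ffunE.
rewrite state_of_rcons /step.
have [/orP[/eqP->|//] _] := best_amountP (state_of h) p.1 p.2.
by apply: feasible_le IHh => u; rewrite amounts_update; case: eqP.
Qed.

Lemma state_of_cat h1 h2 u : u \notin unzip1 h2 ->
  state_of (h1 ++ h2) u = state_of h1 u.
Proof.
elim/last_ind: h2 => [|h2 p IHh]; first by rewrite cats0.
rewrite /unzip1 map_rcons mem_rcons inE negb_or => /andP[up uh].
by rewrite -rcons_cat state_of_rcons ffunE (negPf up) IHh.
Qed.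

Lemma state_of_notin h u : u \notin unzip1 h -> state_of h u = ord0.
Proof. by move=> /(state_of_cat [::]) /= ->; rewrite ffunE. Qed.

Lemma dot_update (v : U -> R) z u t : z u = ord0 ->
  dot v (amounts (update z u t)) = dot v (amounts z) + v u * t%:R.
Proof.
move=> zu; rewrite amounts_update /dot (bigD1 u) //= eqxx addrC; congr (_ + _).
rewrite [RHS](bigD1 u) //= /amounts zu mulr0 add0r.
by apply: eq_bigr => u' /negPf->.
Qed.

Section run.
Context (D : adversary R U) (v : U -> R).
Hypothesis newD : presents_new_elements D.

Local Notation elt k := (D (run D v k)).
Local Notation st k := (state_of (run D v k)).

Lemma run_state_new k : (k < #|U|)%N -> st k (elt k) = ord0.
Proof.
move=> ltk; have [sz un] := run_uniq v newD (ltnW ltk).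
by apply: state_of_notin; apply: newD; rewrite ?sz.
Qed.

Lemma run_state_le i k u : (i <= k <= #|U|)%N -> (st i u <= st k u)%N.
Proof.
elim: k => [|k IHk]; first by rewrite leqn0 => /andP[/eqP->].
case: (ltngtP i k.+1) => //= [|-> //]; rewrite ltnS => lik ltk.
apply: leq_trans (IHk _) _; first by rewrite lik ltnW.
rewrite state_of_rcons ffunE /=; case: eqP => [->|//].
by rewrite run_state_new.
Qed.

Lemma output_state u : output balanced_algorithm D v u =
  (st #|U| u)%:R / N%:R.
Proof.
have [h1 [a [h2 [-> -> uh2]]]] := output_rcons balanced_algorithm v u newD.
by rewrite state_of_cat // /balanced_algorithm by_last_rcons.
Qed.

(** In each round the potential, payoff plus half of [W], grows by exactly the utility: the
    coordinate being fixed was zero before, so choosing zero would leave the state unchanged. *)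
Lemma payoff_identity :
  dot v (amounts (st #|U|)) + 2^-1 * W (amounts (st #|U|)) =
  \sum_(k < #|U|) utility (st k) (elt k) (v (elt k)) + 2^-1 * W (fun=> 0%N).
Proof.
suff H k : (k <= #|U|)%N ->
    dot v (amounts (st k)) + 2^-1 * W (amounts (st k)) =
    \sum_(i < k) utility (st i) (elt i) (v (elt i)) + 2^-1 * W (fun=> 0%N).
  exact: H.
elim: k => [|k IHk] ltk.
  rewrite big_ord0 add0r (_ : amounts _ = fun=> 0%N); last first.
    by apply/funext => u; rewrite /amounts ffunE.
  by rewrite /dot big1 ?add0r // => u _; rewrite mulr0.
have -> : st k.+1 =
    update (st k) (elt k) (best_amount (st k) (elt k) (v (elt k))).
  exact: state_of_rcons.
rewrite big_ord_recr addrAC -(IHk (ltnW ltk)).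
have zk := run_state_new ltk.
rewrite dot_update // /utility /gain update0 // mulr0 add0r; lra.
Qed.

(* Elements are charged to the residual optimum [y] at the final state: fixing
   [y] at an earlier state costs no more than at the final one. *)
Lemma utility_lower_bound (v' : U -> R) :
  (forall z : U -> nat, 0 <= W z) ->
  (forall z z' a : U -> nat, (forall u, z u <= z' u)%N ->
    feasible F (vadd z' a) ->
    W z + W (vadd z' a) <= W (vadd z a) + W z') ->
  (forall u, 0 <= v' u) ->
  opt F v' (amounts (st #|U|)) <=
  \sum_(k < #|U|) utility (st k) (elt k) (v' (elt k)) +
  2^-1 * W (amounts (st #|U|)).
Proof.
move=> W0 dimW v'0; set zn := amounts (st #|U|).
have [y fy ->] := opt_attained v'0 (state_of_feasible (run D v #|U|)).
(* The part of [y] on the first [k] elements of the run, which is driven by [v] and not by [v']. In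
   the claim [H] the losses of [W] telescope along [vadd zn (yk k)]. *)
pose yk k u := if u \in unzip1 (run D v k) then y u else 0%N.
have yn : yk #|U| = y by apply/funext => u; rewrite /yk mem_run.
have H k : (k <= #|U|)%N ->
    dot v' (yk k) - 2^-1 * (W zn - W (vadd zn (yk k))) <=
    \sum_(i < k) utility (st i) (elt i) (v' (elt i)).
  elim: k => [|k IHk] ltk.
    rewrite big_ord0 /dot big1 => [|u _]; last by rewrite mulr0.
    rewrite (_ : vadd _ _ = zn) ?subrr ?mulr0 ?subrr //.
    by apply/funext => u; rewrite /vadd addn0.
  have zk := run_state_new ltk; have [_ un] := run_uniq v newD ltk.
  pose e := elt k; pose ye u := if u == e then y e else 0%N.
  have le_zk u : (amounts (st k) u <= zn u)%N.
    by apply: run_state_le; rewrite (ltnW ltk) leqnn.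
  have ek : e \notin unzip1 (run D v k).
    by move: un; rewrite /= /unzip1 map_rcons rcons_uniq => /andP[].
  have ykS : yk k.+1 = vadd (yk k) ye.
    apply/funext => u; rewrite /vadd /yk /ye /= /unzip1 map_rcons mem_rcons inE.
    by case: eqP => [->|_]; rewrite /= ?(negPf ek) ?addn0.
  have fS : feasible F (vadd (vadd zn (yk k)) ye).
    apply: feasible_le fy => u; rewrite /vadd -addnA leq_add2l.
    have /(congr1 (@^~ u)) := ykS.
    by rewrite /vadd => <-; rewrite /yk; case: ifP.
  have ye_lt : (y e < (capacity F).+1)%N.
    rewrite ltnS; apply: feasible_capacity; apply: feasible_le fy => u.
    exact: leq_addl.
  have updE : amounts (update (st k) e (Ordinal ye_lt)) =
      vadd (amounts (st k)) ye.
    rewrite amounts_update; apply/funext => u; rewrite /vadd /ye /amounts.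
    by case: eqP => [->|]; rewrite ?zk ?addn0.
  have alw : allowed (st k) e (Ordinal ye_lt).
    apply/orP; right; rewrite updE; apply: feasible_le fS => u.
    by rewrite leq_add2r (leq_trans (le_zk u)) // leq_addr.
  have := utility_ge (v' e) alw; rewrite /gain updE update0 //= mulr0 add0r.
  (* Diminishing returns are applied between the state of round [k] and the final state enlarged by
     [yk k]: adding [ye] costs least at the earlier, smaller one. *)
  have le_zk' u : (amounts (st k) u <= vadd zn (yk k) u)%N.
    by apply: leq_trans (le_zk u) _; exact: leq_addr.
  have := dimW _ _ ye le_zk' fS.
  have -> : vadd zn (yk k.+1) = vadd (vadd zn (yk k)) ye.
    by rewrite ykS; apply/funext => u; rewrite /vadd addnA.
  have -> : dot v' (yk k.+1) = dot v' (yk k) + v' e * (y e)%:R.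
    rewrite ykS /dot; under eq_bigr do rewrite /vadd natrD mulrDr.
    rewrite big_split /=; congr (_ + _); rewrite (bigD1 e) //= /ye eqxx.
    by rewrite big1 ?addr0 // => u /negPf->; rewrite mulr0.
  rewrite big_ord_recr /= -/e => dimk utk; have := IHk (ltnW ltk); lra.
have := H _ (leqnn _); rewrite yn; have := W0 (vadd zn y); lra.
Qed.

End run.
End online.

Lemma take_zip (S T : Type) i (s : seq S) (t : seq T) :
  take i (zip s t) = zip (take i s) (take i t).
Proof.
by elim: i s t => [|i IHi] [|x s] [|y t] //=; rewrite ?IHi //; case: (take i _).
Qed.

(** * Measurability of the algorithm and of the adversary's choices *)

Section measurability.
Context (R : realType) (U : finType) (F : {set U} -> nat).
Context (W : (U -> nat) -> R).
Local Notation state := {ffun U -> 'I_(capacity F).+1}.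

Lemma measurable_gain (z : state) u t :
  measurable_fun setT (fun a : R => gain W z u a t).
Proof.
apply: measurable_funD => //; apply: measurable_funM => //.
Qed.

(** The choice depends on the weight only through the finite table [l] of comparisons between gains,
    and each comparison is a measurable condition. *)
Lemma measurable_best_amount (z : state) u :
  measurable_label (best_amount W z u).
Proof.
pose c (l : {ffun 'I_(capacity F).+1 * 'I_(capacity F).+1 -> bool}) :=
  odflt ord0 [pick t | allowed z u t &&
    [forall t', allowed z u t' ==> l (t', t)]].
pose l a := [ffun p : 'I_(capacity F).+1 * 'I_(capacity F).+1 =>
  gain W z u a p.1 <= gain W z u a p.2].
rewrite (_ : best_amount W z u = c \o l).
  apply/measurable_label_comp/measurable_label_ffun => p b.
  rewrite -[_ @^-1` _]setTI; apply: measurable_fun_ler => //;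
  exact: measurable_gain.
apply/funext => a; rewrite /best_amount /c /=; congr odflt.
apply: eq_pick => t /=.
by congr andb; apply: eq_forallb => t'; rewrite ffunE.
Qed.

Lemma measurable_utility (z : state) u : measurable_fun setT (utility W z u).
Proof.
apply: measurable_funB; last exact: measurable_gain.
apply: (@measurable_fun_label _ _ _ _ _ (best_amount W z u)
  (fun t a => gain W z u a t)); first exact: measurable_best_amount.
by move=> t; exact: measurable_gain.
Qed.

(** Induction on prefixes: for each of the finitely many earlier states, the next state is a
    measurable label of a single weight. *)
Lemma measurable_state_of k (s : k.-tuple U) :
  measurable_label (fun t : k.-tuple R => state_of F W (zip s t)).
Proof.
have szz (t : k.-tuple R) : size (zip s t) = k.
  by rewrite size_zip !size_tuple minnn.
suff H i : (i <= k)%N ->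
    measurable_label (fun t : k.-tuple R => state_of F W (take i (zip s t))).
  have := H k (leqnn k); congr measurable_label; apply/funext => t.
  by rewrite take_oversize ?szz.
elim: i => [|i IHi] ltik.
  rewrite (_ : (fun _ => _) = cst [ffun=> ord0]).
    exact: measurable_label_cst.
  by apply/funext => t; rewrite take0.
pose i' := Ordinal ltik.
pose g (z : state) (t : k.-tuple R) := step W z (tnth s i', tnth t i').
rewrite (_ : (fun _ => _) =
    fun t : k.-tuple R => g (state_of F W (take i (zip s t))) t).
  apply: measurable_label_bind (IHi (ltnW ltik)) _ => z.
  apply: (@measurable_label_precomp _ _ _ _ _ (@tnth k R ^~ i')
    (fun a => update z (tnth s i') (best_amount W z (tnth s i') a))).
    exact: measurable_tnth.
  apply: (@measurable_label_comp _ _ _ _ _ (update z (tnth s i'))).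
  exact: measurable_best_amount.
apply/funext => t /=.
have [u0 a0] : U * R by split; [exact: tnth s i'|exact: 0].
rewrite (take_nth (u0, a0)) ?szz // state_of_rcons nth_zip ?size_tuple //.
by rewrite /g (tnth_nth u0) (tnth_nth a0).
Qed.

Lemma measurable_by_last (g : history R U -> U -> R) :
  (forall k (s : k.-tuple U) u,
    measurable_fun setT (fun t : k.-tuple R => g (zip s t) u)) ->
  measurable_algorithm (by_last g).
Proof.
move=> mg [|k] s.
  rewrite (_ : (fun _ => _) = cst 0) //.
  by apply/funext => t; rewrite tuple0 (tuple0 t).
rewrite (_ : (fun _ => _) =
    fun t : k.+1.-tuple R => g (zip s t) (last (thead s) s)) //.
apply/funext => t; case/tupleP: s => u s; case/tupleP: t => a t.
rewrite /by_last /=; congr g.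
by rewrite -(last_map fst (zip s t) (u, a)) [map _ _]unzip1_zip ?size_tuple.
Qed.

Lemma measurable_balanced_algorithm N :
  measurable_algorithm (balanced_algorithm F W N).
Proof.
apply: measurable_by_last => k s u.
pose g (z : state) (_ : k.-tuple R) : R := (z u)%:R / N%:R.
apply: (@measurable_fun_label _ _ _ _ _ _ g (measurable_state_of s)) => z.
exact: measurable_cst.
Qed.

(** The event that [D] presents [s] in this order, expressed through the weights of [s] alone; see
    [consistentP]. *)
Definition consistent (D : adversary R U) k (s : k.-tuple U) :
    set (k.-tuple R) :=
  [set t | forall i : 'I_k, D (take i (zip s t)) = tnth s i].

Lemma measurable_prefix (D : adversary R U) k (s : k.-tuple U) (i : 'I_k.+1) u :
  measurable_adversary D ->
  measurable [set t : k.-tuple R | D (take i (zip s t)) = u].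
Proof.
move=> mD; have le_ik : (i <= k)%N by rewrite -ltnS.
pose pre T (t : k.-tuple T) : i.-tuple T :=
  tcast (minn_idPl le_ik) [tuple of take i t].
have preE T (t : k.-tuple T) : take i t = pre T t by rewrite val_tcast.
have mpre : measurable_fun setT (pre R).
  apply/measurable_fun_tnthP => j.
  rewrite (_ : _ \o _ = @tnth k R ^~ (widen_ord le_ik j)).
    exact: measurable_tnth.
  by apply/funext => t /=; rewrite !(tnth_nth 0) -preE nth_take.
rewrite (_ : [set t | _] = pre R @^-1` [set t | D (zip (pre U s) t) = u]).
  by rewrite -[_ @^-1` _]setTI; apply: mpre => //; exact: mD.
by apply/seteqP; split=> t /=; rewrite take_zip !preE.
Qed.

End measurability.

(** * The order of presentation along a run *)

Section run_history.
Context (R : realType) (U : finType) (D : adversary R U) (v : U -> R).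

Definition presented k : k.-tuple U :=
  map_tuple (fun i => D (run D v i)) (iota_tuple k 0).

Lemma presentedS k :
  presented k.+1 = rcons (presented k) (D (run D v k)) :> seq U.
Proof.
transitivity [seq D (run D v i) | i <- iota 0 (k + 1)]; first by rewrite addn1.
by rewrite iotaD map_cat cats1.
Qed.

Lemma run_presented k : run D v k = [seq (u, v u) | u <- presented k].
Proof.
by elim: k => [//|k IHk]; rewrite presentedS map_rcons /= {1}IHk.
Qed.

Lemma unzip1_run k : unzip1 (run D v k) = presented k.
Proof. by rewrite run_presented /unzip1 -map_comp map_id. Qed.

Lemma take_run i k : (i <= k)%N -> take i (run D v k) = run D v i.
Proof.
move=> le_ik; rewrite !run_presented -!map_take /= take_iota.
by rewrite (minn_idPl le_ik).
Qed.

Lemma zip_weights (s : seq U) : zip s (map v s) = [seq (u, v u) | u <- s].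
Proof. by rewrite -{1}(map_id s) zip_map. Qed.

Lemma consistentP k (s : k.-tuple U) :
  consistent D s (map_tuple v s) <-> presented k = s.
Proof.
split=> [cons|<- i]; last first.
  rewrite /= zip_weights -run_presented take_run ?(ltnW (ltn_ord i)) //.
  by rewrite (tnth_nth (D [::])) (nth_map 0%N) ?size_iota // nth_iota.
have H i : (i <= k)%N -> run D v i = take i (zip s (map v s)).
  elim: i => [|i IHi] ltik /=; first by rewrite take0.
  rewrite IHi ?(ltnW ltik) // (cons (Ordinal ltik)).
  have sz : size (zip s (map v s)) = k.
    by rewrite zip_weights size_map size_tuple.
  pose u0 := tnth s (Ordinal ltik).
  rewrite (take_nth (u0, v u0)) ?sz // zip_weights (nth_map u0) ?size_tuple //.
  by rewrite (tnth_nth u0).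
apply: val_inj; rewrite -[LHS]unzip1_run (H k) // take_oversize.
  by rewrite unzip1_zip ?size_map.
by rewrite zip_weights size_map size_tuple.
Qed.

End run_history.

(** * Expectations when the optimum is integrable *)

Section prophet.
Context (d : measure_display) (Omega : measurableType d) (R : realType).
Context (P : probability Omega R) (U : finType) (F : {set U} -> nat).
Context (w : U -> {RV P >-> R}).
Hypothesis submodF :
  forall X Y, (F (X :&: Y)%SET + F (X :|: Y)%SET <= F X + F Y)%N.
Hypothesis w_ge0 : forall u x, 0 <= w u x.
Hypothesis indep : independent_RVs w.
Local Notation state := {ffun U -> 'I_(capacity F).+1}.
Local Notation wt x := (fun u => w u x).

Lemma measurable_dot (y : U -> nat) :
  measurable_fun setT (fun x => dot (wt x) y).
Proof.
apply: measurable_sum => u; apply: measurable_funM => //.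
Qed.

Lemma measurable_opt (z : U -> nat) :
  measurable_fun setT (fun x => opt F (wt x) z).
Proof. by apply: measurable_bigmaxr => y; exact: measurable_dot. Qed.

Hypothesis opt_fin : (\int[P]_x (opt F (wt x) (fun=> 0%N))%:E < +oo)%E.

Definition value (z : U -> nat) : R :=
  fine (\int[P]_x (opt F (wt x) z)%:E)%E.

Lemma value_integral z : (value z)%:E = (\int[P]_x (opt F (wt x) z)%:E)%E.
Proof.
rewrite /value fineK // ge0_fin_numE; last first.
  by apply: integral_ge0 => x _; rewrite lee_fin opt_ge0.
apply: le_lt_trans opt_fin; apply: ge0_le_integral => //.
- by move=> x _; rewrite lee_fin opt_ge0.
- by apply/measurable_EFinP; exact: measurable_opt.
- by apply/measurable_EFinP; exact: measurable_opt.
- by move=> x _; rewrite lee_fin opt_antitone.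
Qed.

Lemma value_ge0 z : 0 <= value z.
Proof.
rewrite -lee_fin value_integral.
by apply: integral_ge0 => x _; rewrite lee_fin opt_ge0.
Qed.

Lemma value_le0 z : value z <= value (fun=> 0%N).
Proof.
rewrite -lee_fin !value_integral; apply: ge0_le_integral => //.
- by move=> x _; rewrite lee_fin opt_ge0.
- by apply/measurable_EFinP; exact: measurable_opt.
- by apply/measurable_EFinP; exact: measurable_opt.
- by move=> x _; rewrite lee_fin opt_antitone.
Qed.

Lemma value_diminishing (z z' a : U -> nat) :
  (forall u, z u <= z' u)%N -> feasible F (vadd z' a) ->
  value z + value (vadd z' a) <= value (vadd z a) + value z'.
Proof.
move=> zz' fz'a; rewrite -lee_fin !EFinD !value_integral.
have m y : measurable_fun setT (fun x => (opt F (wt x) y)%:E).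
  by apply/measurable_EFinP; exact: measurable_opt.
have ge0 y x : [set: Omega] x -> (0 <= (opt F (wt x) y)%:E)%E.
  by rewrite lee_fin opt_ge0.
rewrite -[leLHS]ge0_integralD //; [|exact: ge0..].
rewrite -[leRHS]ge0_integralD //; [|exact: ge0..]; apply: ge0_le_integral => //.
- by move=> x _; rewrite -EFinD lee_fin addr_ge0 ?opt_ge0.
- exact: emeasurable_funD.
- exact: emeasurable_funD.
- by move=> x _; rewrite -!EFinD lee_fin opt_diminishing.
Qed.

Definition expected_utility (z : state) (u : U) : \bar R :=
  (\int[P]_x (utility value z u (w u x))%:E)%E.

Lemma measurable_utility_weight (z : state) u :
  measurable_fun setT (fun x => (utility value z u (w u x))%:E).
Proof.
apply/measurable_EFinP.
by apply: measurableT_comp (measurable_utility value z u) _.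
Qed.

Lemma expected_utility_ge0 z u : (0 <= expected_utility z u)%E.
Proof. by apply: integral_ge0 => x _; rewrite lee_fin utility_ge0. Qed.

Section adversary.
Context (D : adversary R U).
Hypotheses (mD : measurable_adversary D) (newD : presents_new_elements D).
Local Notation elt k x := (D (run D (wt x) k)).
Local Notation st k x := (state_of F value (run D (wt x) k)).

(** A finite label holding everything that the utility of round [k] depends on, apart from the
    weight of the element presented. *)
Definition round k (x : Omega) : k.-tuple U * U * state :=
  (presented D (wt x) k, elt k x, st k x).

(** Writes the event in terms of the weights of [s] only, which makes it independent of the weight
    of [u]. *)
Lemma round_preimage k (s : k.-tuple U) u (z : state) :
  round k @^-1` [set (s, u, z)] = weights w s @^-1`
    (consistent D s `&` [set t | D (zip s t) = u] `&`
     [set t | state_of F value (zip s t) = z]).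
Proof.
apply/seteqP; split=> x /=.
- case=> sE uE zE; split; first split.
  + exact/consistentP.
  + by rewrite -sE zip_weights -run_presented.
  + by rewrite -sE zip_weights -run_presented.
- move=> [[/consistentP sE]]; rewrite zip_weights -sE -run_presented => <- <-.
  by rewrite /round sE.
Qed.

Lemma measurable_round_set k (s : k.-tuple U) u (z : state) :
  measurable (consistent D s `&` [set t | D (zip s t) = u] `&`
     [set t | state_of F value (zip s t) = z]).
Proof.
apply: measurableI; last exact: measurable_state_of.
apply: measurableI; last exact: mD.
rewrite (_ : consistent D s = \bigcap_(i in [set: 'I_k])
    [set t | D (take i (zip s t)) = tnth s i]); last first.
  by apply/seteqP; split=> [t ct i _|t ct i]; [exact: ct|exact: (ct i I)].
apply: fin_bigcap_measurable => // i _.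
exact: (measurable_prefix _ (widen_ord (leqnSn k) i)).
Qed.

Lemma measurable_round k : measurable_label (@round k).
Proof.
move=> [[s u] z]; rewrite round_preimage -[_ @^-1` _]setTI.
by apply: measurable_weights => //; exact: measurable_round_set.
Qed.

Lemma round_uniq k x : (k < #|U|)%N -> uniq (elt k x :: presented D (wt x) k).
Proof.
move=> ltk; have [_] := run_uniq (wt x) newD ltk.
by rewrite /= /unzip1 map_rcons rcons_uniq -/(unzip1 _) unzip1_run.
Qed.

(* The adversary picks the next element before seeing its weight. *)
Lemma integral_utility k : (k < #|U|)%N ->
  (\int[P]_x (utility value (st k x) (elt k x) (w (elt k x) x))%:E =
   \int[P]_x expected_utility (st k x) (elt k x))%E.
Proof.
move=> ltk.
pose g (j : k.-tuple U * U * state) x :=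
  (utility value j.2 j.1.2 (w j.1.2 x))%:E.
pose g' (j : k.-tuple U * U * state) (x : Omega) :=
  expected_utility j.2 j.1.2.
rewrite -[LHS]/(\int[P]_x g (round k x) x)%E.
rewrite -[RHS]/(\int[P]_x g' (round k x) x)%E.
rewrite !integral_label //; last 6 first.
- exact: measurable_round.
- by move=> j; exact: measurable_cst.
- by move=> j x; exact: expected_utility_ge0.
- exact: measurable_round.
- by move=> j; exact: measurable_utility_weight.
- by move=> j x; rewrite lee_fin utility_ge0.
apply: eq_bigr => -[[s u] z] _; rewrite /g /g' /=.
(* A label in which an element repeats has an empty fibre. For the others the weight of [u] is
   independent of the fibre. *)
have [us|us] := boolP (uniq (u :: s)); last first.
  rewrite (_ : _ @^-1` _ = set0) ?integral_set0 //.
  apply/seteqP; split=> // x /= [sE uE _]; move: us.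
  by rewrite -sE -uE round_uniq.
rewrite integral_cst; last exact: measurable_round.
rewrite round_preimage.
rewrite (independent_integral indep us); first by rewrite muleC.
- exact: measurable_round_set.
- exact: measurable_utility.
- by move=> r; exact: utility_ge0.
Qed.

Lemma measurable_utility_round k :
  measurable_fun setT
    (fun x => (utility value (st k x) (elt k x) (w (elt k x) x))%:E).
Proof.
apply: (measurable_fun_label
  (g := fun (j : k.-tuple U * U * state) x =>
    (utility value j.2 j.1.2 (w j.1.2 x))%:E) (@measurable_round k)).
by move=> j; exact: measurable_utility_weight.
Qed.

Lemma measurable_expected_utility_round k :
  measurable_fun setT (fun x => expected_utility (st k x) (elt k x)).
Proof.
apply: (measurable_fun_label
  (g := fun (j : k.-tuple U * U * state) x => expected_utility j.2 j.1.2)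
  (@measurable_round k)).
by move=> j; exact: measurable_cst.
Qed.

(** The run at [x] is held fixed and [utility_lower_bound] is averaged over an independent copy [y]
    of the weights. The optimum left at the final state then averages to its [value], half of which
    the bound itself gives back. *)
Lemma sum_expected_utility x :
  ((2^-1 * value (amounts (st #|U| x)))%:E <=
   \sum_(k < #|U|) expected_utility (st k x) (elt k x))%E.
Proof.
set c := 2^-1 * _.
have -> : c%:E = ((value (amounts (st #|U| x)))%:E - c%:E)%E.
  by rewrite -EFinB; congr EFin; rewrite /c; lra.
rewrite leeBlDr // value_integral.
have -> : (\sum_(k < #|U|) expected_utility (st k x) (elt k x) + c%:E =
    \int[P]_y (\sum_(k < #|U|) utility value (st k x) (elt k x) (w (elt k x) y)
      + c)%:E)%E.
  under [RHS]eq_integral do rewrite EFinD -sumEFin.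
  rewrite ge0_integralD //=; last 3 first.
  - by move=> y _; apply: sume_ge0 => k _; rewrite lee_fin utility_ge0.
  - by apply: emeasurable_sum => k; exact: measurable_utility_weight.
  - by move=> y _; rewrite lee_fin mulr_ge0 ?value_ge0 // invr_ge0.
  rewrite integral_cst //= probability_setT mule1; congr (_ + _)%E.
  rewrite ge0_integral_sum //.
  - by move=> k; exact: measurable_utility_weight.
  - by move=> k y _; rewrite lee_fin utility_ge0.
apply: ge0_le_integral => //.
- by move=> y _; rewrite lee_fin opt_ge0.
- by apply/measurable_EFinP; exact: measurable_opt.
- apply/measurable_EFinP; apply: measurable_funD => //.
  apply: measurable_sum => k; apply/measurable_EFinP.
  exact: measurable_utility_weight.
- move=> y _; rewrite lee_fin; apply: utility_lower_bound => //.
  + exact: value_ge0.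
  + exact: value_diminishing.
Qed.

Lemma measurable_payoff :
  measurable_fun setT (fun x => dot (wt x) (amounts (st #|U| x))).
Proof.
apply/measurable_EFinP.
apply: (measurable_fun_label (g := fun (j : #|U|.-tuple U * U * state) x =>
  (dot (wt x) (amounts j.2))%:E) (@measurable_round #|U|)).
by move=> j; apply/measurable_EFinP; exact: measurable_dot.
Qed.

(** Adding half of the final value, [Y], to both sides turns the right-hand side into total utility
    plus half of the initial value, by [payoff_identity]. It remains to bound the expectation of [Y]
    by the expected total utility, where each weight may be averaged separately. *)
Lemma half_value_le_payoff :
  ((2^-1)%:E * \int[P]_x (opt F (wt x) (fun=> 0%N))%:E <=
   \int[P]_x (dot (wt x) (amounts (st #|U| x)))%:E)%E.
Proof.
pose Y x := 2^-1 * value (amounts (st #|U| x)).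
have h0 : 0 <= 2^-1 :> R by rewrite invr_ge0.
have Y0 x : (0 <= (Y x)%:E)%E by rewrite lee_fin mulr_ge0 ?value_ge0.
have mY : measurable_fun setT (fun x => (Y x)%:E).
  apply: (measurable_fun_label (g := fun (j : #|U|.-tuple U * U * state) x =>
    (2^-1 * value (amounts j.2))%:E) (@measurable_round #|U|)).
  by move=> j; exact: measurable_cst.
have Yfin : (\int[P]_x (Y x)%:E)%E \is a fin_num.
  rewrite ge0_fin_numE ?integral_ge0 //.
  apply: (@le_lt_trans _ _ (\int[P]_x (2^-1 * value (fun=> 0%N))%:E)%E).
    apply: ge0_le_integral => // x _.
    by rewrite lee_fin ler_wpM2l // value_le0.
  by rewrite integral_cst //= probability_setT mule1 ltry.
(* Cancelling [Y] is legitimate in the extended reals because its expectation is finite. *)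
rewrite -value_integral -EFinM -(leeD2rE _ _ Yfin).
rewrite -ge0_integralD //; last 2 first.
- by move=> x _; rewrite lee_fin dot_ge0.
- by apply/measurable_EFinP; exact: measurable_payoff.
under [leRHS]eq_integral do rewrite -EFinD payoff_identity // EFinD -sumEFin.
rewrite [leRHS]ge0_integralD //=; last 3 first.
- by move=> x _; apply: sume_ge0 => k _; rewrite lee_fin utility_ge0.
- by apply: emeasurable_sum => k; exact: measurable_utility_round.
- by move=> x _; rewrite lee_fin mulr_ge0 ?value_ge0.
rewrite integral_cst //= probability_setT mule1 addeC leeD2r //.
rewrite ge0_integral_sum //; last 2 first.
- by move=> k; exact: measurable_utility_round.
- by move=> k x _; rewrite lee_fin utility_ge0.
under eq_bigr => k _ do rewrite integral_utility //.
rewrite -ge0_integral_sum //; last 2 first.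
- by move=> k; exact: measurable_expected_utility_round.
- by move=> k x _; exact: expected_utility_ge0.
apply: ge0_le_integral => //.
- by apply: emeasurable_sum => k; exact: measurable_expected_utility_round.
- by move=> x _; exact: sum_expected_utility.
Qed.

End adversary.
End prophet.

(** * Scaling to integers *)

Lemma common_denominator (I : finType) (f : I -> rat) : (forall i, 0 <= f i) ->
  exists (N : nat) (F : I -> nat),
    (0 < N)%N /\ forall i, f i = (F i)%:R / N%:R.
Proof.
move=> f0; pose N := (\prod_i `|denq (f i)|)%N.
have den0 i : (0 < `|denq (f i)|)%N by rewrite absz_gt0 denq_neq0.
exists N, (fun i => (`|numq (f i)| * \prod_(j | j != i) `|denq (f j)|)%N).
split=> [|i]; first by apply: prodn_gt0 => i; exact: den0.
have -> : N = (`|denq (f i)| * \prod_(j | j != i) `|denq (f j)|)%N.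
  by rewrite /N (bigD1 i).
rewrite !natrM -mulf_div divff ?mulr1; last first.
  by rewrite pnatr_eq0 -lt0n; apply: prodn_cond_gt0.
by rewrite -[LHS]divq_num_den !pmulrn !gez0_abs ?numq_ge0.
Qed.

(** * A fixed vector for the case of an infinite expected optimum *)

Section uniform_vector.
Context (R : realType) (U : finType) (F : {set U} -> nat) (N : nat).

(* A single vector of the polymatroid which is positive at every coordinate
   where the polymatroid allows it. *)
Definition uniform_vector (u : U) : R :=
  if feasible F (fun u' => nat_of_bool (u' == u))
  then (#|U|.+1%:R * N%:R)^-1 else 0.

(** If [F T] is zero, no unit vector of an element of [T] is feasible and the sum over [T] vanishes.
    Otherwise the bound for [T] is at least [1 / N], which the at most [#|U|] equal coordinates do
    not exceed. The successor in [#|U|.+1] keeps the denominator positive. *)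
Lemma uniform_vector_polymatroid (f : {set U} -> rat) :
  (0 < N)%N -> (forall S, ratr (f S) = (F S)%:R / N%:R :> R) ->
  polymatroid f uniform_vector.
Proof.
move=> N0 fE.
have c0 : 0 <= (#|U|.+1%:R * N%:R)^-1 :> R by rewrite invr_ge0 mulr_ge0.
have u0 u : 0 <= uniform_vector u by rewrite /uniform_vector; case: ifP.
split=> // T; rewrite fE.
have [F0|F0] := posnP (F T).
  rewrite F0 mul0r big1 // => u Tu; rewrite /uniform_vector; case: ifP => //.
  move=> /feasibleP/(_ T); rewrite F0 leqn0 /vsum (bigD1 u) //= eqxx.
  by [].
apply: (@le_trans _ _ N%:R^-1); last first.
  by rewrite ler_peMl ?invr_ge0 // ler1n.
apply: (@le_trans _ _ (\sum_(u in T) (#|U|.+1%:R * N%:R)^-1)).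
  by apply: ler_sum => u _; rewrite /uniform_vector; case: ifP.
rewrite sumr_const -[_ *+ _]mulr_natl invfM mulrA ler_piMl ?invr_ge0 //.
by rewrite ler_pdivrMr ?ltr0n // mul1r ler_nat (leq_trans (max_card _)).
Qed.

(** Each coordinate of an optimal grid vector is at most [capacity F], and it is zero wherever the
    unit vector is infeasible. *)
Lemma opt_le_uniform (v : U -> R) : (0 < N)%N ->
  (forall u, 0 <= v u) -> feasible F (fun=> 0%N) ->
  opt F v (fun=> 0%N) <=
  (capacity F)%:R * (#|U|.+1%:R * N%:R) * \sum_u v u * uniform_vector u.
Proof.
move=> N0 v0 f0; have [y fy ->] := opt_attained v0 f0.
rewrite mulr_sumr; apply: ler_sum => u _.
rewrite mulrCA ler_wpM2l //.
have fy' : feasible F y by apply: feasible_le fy.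
rewrite /uniform_vector; case: ifPn => [_|nf].
  rewrite mulfK ?ler_nat ?feasible_capacity //.
  by rewrite mulf_neq0 ?pnatr_eq0 // -lt0n.
rewrite mulr0 lern0; apply/negPn/negP => yu; case/negP: nf.
apply: feasible_le fy' => u'; case: eqP => //= ->; by rewrite lt0n.
Qed.

End uniform_vector.

Theorem theorem2 (R : realType) (U : finType) (f : {set U} -> rat)
    (d : measure_display) (Omega : measurableType d) (P : probability Omega R)
    (w : U -> {RV P >-> R}) :
  (forall S : {set U}, 0 <= f S) ->
  submodular f ->
  (forall (u : U) (x : Omega), 0 <= w u x) ->
  independent_RVs w ->
  exists A : algorithm R U,
    measurable_algorithm A /\
    forall D : adversary R U,
      measurable_adversary D -> presents_new_elements D ->
      (forall x : Omega, polymatroid f (output A D (fun u => w u x))) /\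
      ((2^-1)%:E * 'E_P[fun x => max_weight f (fun u => w u x)] <=
       'E_P[fun x => (\sum_u w u x * output A D (fun u => w u x) u)%R])%E.
Proof.
move=> f0 subf w0 indep.
have [N [F [N0 fE]]] := common_denominator f0.
have NR0 : 0 < N%:R :> R by rewrite ltr0n.
have Q0 : 0 < N%:R^-1 :> rat by rewrite invr_gt0 ltr0n.
have fRE S : ratr (f S) = (F S)%:R / N%:R :> R.
  by rewrite fE fmorph_div /= !ratr_nat.
have submodF X Y : (F (X :&: Y)%SET + F (X :|: Y)%SET <= F X + F Y)%N.
  have := subf X Y; rewrite !fE -!mulrDl ler_pM2r // -!natrD.
  by rewrite ler_nat.
have feas0 : feasible F (fun=> 0%N) by apply/feasibleP => T; rewrite /vsum big1.
have EN (X : Omega -> R) : measurable_fun setT X -> (forall x, 0 <= X x) ->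
    ('E_P[fun x => (X x / N%:R)%R] = (N%:R^-1)%R%:E * \int[P]_x (X x)%:E)%E.
  move=> mX X0; rewrite unlock -ge0_integralZl //.
  - by apply: eq_integral => x _; rewrite -EFinM mulrC.
  - exact/measurable_EFinP.
  - by move=> x _; rewrite lee_fin.
have mo := measurable_opt F w (fun=> 0%N).
have maxE : ('E_P[fun x => max_weight f (fun u => w u x)] =
    (N%:R^-1)%R%:E * \int[P]_x (opt F (fun u => w u x) (fun=> 0%N))%:E)%E.
  rewrite -EN //; last by move=> x; exact: opt_ge0.
  by congr expectation; apply/funext => x; exact: max_weight_opt.
rewrite maxE.
(* Which case holds depends only on the law of the weights, so the algorithm may be chosen
   accordingly. *)
have [fin|] := boolP
  (\int[P]_x (opt F (fun u => w u x) (fun=> 0%N))%:E < +oo)%E.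
  exists (balanced_algorithm F (value F w) N).
  split=> [|D mD newD]; first exact: measurable_balanced_algorithm.
  split=> [x|].
    split=> [u|T]; first by rewrite output_state // divr_ge0.
    under eq_bigr do rewrite output_state //.
    rewrite fRE -mulr_suml ler_pM2r ?invr_gt0 // -natr_sum ler_nat.
    exact: (feasibleP _ _ (state_of_feasible _ _ _)).
  pose X x := dot (fun u => w u x)
    (amounts (state_of F (value F w) (run D (fun u => w u x) #|U|))).
  have -> : (fun x => \sum_u w u x *
      output (balanced_algorithm F (value F w) N) D (fun u => w u x) u) =
      fun x => X x / N%:R.
    apply/funext => x; rewrite /X /dot mulr_suml; apply: eq_bigr => u _.
    by rewrite output_state // mulrA.
  rewrite EN; last 2 first.
  - exact: measurable_payoff.
  - by move=> x; apply: dot_ge0.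
  rewrite muleCA lee_wpmul2l ?lee_fin ?invr_ge0 //.
  exact: half_value_le_payoff.
rewrite -leNgt leye_eq => /eqP optoo.
exists (by_last (fun _ => uniform_vector R F N)); split=> [|D mD newD].
  by apply: measurable_by_last => k s u; exact: measurable_cst.
have outE v u : output (by_last (fun _ => uniform_vector R F N)) D v u =
    uniform_vector R F N u.
  have [h1 [a [h2 [-> _ _]]]] := output_rcons
    (by_last (fun _ => uniform_vector R F N)) v u newD.
  by rewrite by_last_rcons.
split=> [x|].
  rewrite (_ : output _ _ _ = uniform_vector R F N).
    exact: uniform_vector_polymatroid.
  exact/funext.
rewrite [leRHS](_ : _ = +oo%E) ?leey //.
under eq_fun do under eq_bigr do rewrite outE.
rewrite unlock; set I := (\int[P]_x _)%E.
have mI : measurable_fun setT (fun x => \sum_u w u x * uniform_vector R F N u).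
  by apply: measurable_sum => u; apply: measurable_funM.
have [u0 _] := uniform_vector_polymatroid N0 fRE.
have I0 : (0 <= I)%E.
  apply: integral_ge0 => x _; rewrite lee_fin sumr_ge0 // => u _.
  by rewrite mulr_ge0.
pose K : R := (capacity F)%:R * (#|U|.+1%:R * N%:R).
have K0 : 0 <= K by rewrite !mulr_ge0.
(* A finite multiple of the expected payoff [I] dominates an infinite integral, so [I] is
   infinite. *)
have : (\int[P]_x (opt F (fun u => w u x) (fun=> 0%N))%:E <= K%:E * I)%E.
  rewrite -ge0_integralZl //.
  - apply: ge0_le_integral => //.
    + by move=> x _; rewrite lee_fin opt_ge0.
    + exact/measurable_EFinP.
    + by apply/measurable_EFinP; exact: measurable_funM.
    + by move=> x _; rewrite -EFinM lee_fin opt_le_uniform.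
  - exact/measurable_EFinP.
  - by move=> x _; rewrite lee_fin sumr_ge0 // => u _; rewrite mulr_ge0.
rewrite optoo leye_eq; case: I I0 => [r| |] //.
Qed.
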